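(* For every integer $k \geq 1$, the Bernoulli number $B_k$ (with the convention $B_1 = -\tfrac12$) is given by the $k \times k$ determinant $$ B_{k} = \frac{(-1)^k}{(k+1)!} \begin{vmatrix} \binom{2}{1} & 0 & 0 & \cdots & 0 & 1 \\ \binom{3}{1} & \binom{3}{2} & 0 & \cdots & 0 & 2 \\ \binom{4}{1} & \binom{4}{2} & \binom{4}{3} & \cdots & 0 & 3 \\ \vdots & \vdots & \vdots & \ddots & \vdots & \vdots \\ \binom{k}{1} & \binom{k}{2} & \binom{k}{3} & \cdots & \binom{k}{k-1} & k-1 \\ \binom{k+1}{1} & \binom{k+1}{2} & \binom{k+1}{3} & \cdots & \binom{k+1}{k-1} & k \end{vmatrix}. $$ That is, $B_k = \frac{(-1)^k}{(k+1)!}\det M$, where $M = (M_{i,j})_{1\le i,j\le k}$ has entries $M_{i,j} = \binom{i+1}{j}$ if $1 \le j \le k-1$ and $j \le i$, $M_{i,j} = 0$ if $1 \le j \le k-1$ and $j > i$, and $M_{i,k} = i$ for all $1\le i\le k$.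
   Context: The Bernoulli numbers are normalized so that $B_0 = 1$, $B_1 = -\frac12$, $B_2 = \frac16$, $B_3 = 0$, $B_4 = -\frac1{30}$, etc., i.e. $\frac{t}{e^t-1} = \sum_{m\ge 0} B_m \frac{t^m}{m!}$. *)

(* Defs.v *)
From mathcomp Require Import all_boot all_order all_algebra.

Set Implicit Arguments.
Unset Strict Implicit.
Unset Printing Implicit Defensive.

Import Order.TTheory GRing.Theory Num.Theory.

Local Open Scope ring_scope.

(* Formal power series over rat, as coefficient sequences. *)
Definition fps := nat -> rat.

Definition fps_X : fps := fun n => (n == 1%N)%:R.

Definition fps_expm1 : fps := fun n => if n is 0%N then 0 else (n`!)%:R^-1.

Definition fps_mul (f g : fps) : fps :=
  fun n => \sum_(i < n.+1) f i * g (n - i)%N.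

Definition fps_divX (f : fps) : fps := fun n => f n.+1.

(* The first n coefficients of 1 / f, assuming f 0 != 0. *)
Fixpoint fps_inv_seq (f : fps) (n : nat) : seq rat :=
  if n is m.+1 then
    let s := fps_inv_seq f m in
    rcons s (((m == 0%N)%:R - \sum_(i < m) s`_i * f (m - i)%N) / f 0%N)
  else [::].

Definition fps_inv (f : fps) : fps := fun n => (fps_inv_seq f n.+1)`_n.

(* t / (e^t - 1), computed as the inverse of (e^t - 1) / t, whose constant
   coefficient is 1; see bernoulli_genE. *)
Definition bernoulli_gen : fps := fps_inv (fps_divX fps_expm1).

Definition bernoulli (m : nat) : rat := (m`!)%:R * bernoulli_gen m.

(* Rows and columns are indexed from 0: the entry (i, j) below is the entry
   (i + 1, j + 1) of the matrix in the usual 1-based indexing. The test i < j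
   is needed, since 'C(i.+2, j.+1) = 1, not 0, on the superdiagonal. *)
Definition bernoulli_mx (k : nat) : 'M[rat]_k :=
  \matrix_(i < k, j < k)
    if j.+1 == k then (i.+1)%:R
    else if (i < j)%N then 0
    else ('C(i.+2, j.+1))%:R.

Lemma size_fps_inv_seq f n : size (fps_inv_seq f n) = n.
Proof. by elim: n => //= n IH; rewrite size_rcons IH. Qed.

Lemma nth_fps_inv_seq f n i : (i < n)%N -> (fps_inv_seq f n)`_i = fps_inv f i.
Proof.
elim: n => // n IH; rewrite ltnS leq_eqVlt => /orP[/eqP -> //|lt_in].
by rewrite /= nth_rcons size_fps_inv_seq lt_in IH.
Qed.

Lemma fps_mulV (f : fps) n :
  f 0%N != 0 -> fps_mul (fps_inv f) f n = (n == 0%N)%:R.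
Proof.
move=> f0; rewrite /fps_mul big_ord_recr /= subnn {2}/fps_inv /=.
rewrite nth_rcons size_fps_inv_seq ltnn eqxx divfK //.
rewrite [X in _ - X](eq_bigr (fun i : 'I_n => fps_inv f i * f (n - i)%N)).
  by rewrite addrC subrK.
by move=> i _; rewrite nth_fps_inv_seq.
Qed.

Lemma bernoulli_genE n :
  fps_mul (fun m => bernoulli m / (m`!)%:R) fps_expm1 n = fps_X n.
Proof.
have E m : bernoulli m / (m`!)%:R = bernoulli_gen m.
  by rewrite /bernoulli mulrC mulKf // pnatr_eq0 -lt0n fact_gt0.
rewrite /fps_mul; under eq_bigr do rewrite E.
rewrite big_ord_recr /= subnn /= mulr0 addr0; case: n => [|n].
  by rewrite big_ord0.
rewrite /fps_X eqSS -(@fps_mulV (fps_divX fps_expm1)) //.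
by apply: eq_bigr => i _; rewrite /fps_divX -subSn // -ltnS.
Qed.

Lemma bernoulli_uniq (B : nat -> rat) :
  (forall n, fps_mul (fun m => B m / (m`!)%:R) fps_expm1 n = fps_X n) ->
  B =1 bernoulli.
Proof.
move=> hB m; have [n] := ubnP m; elim: n m => // n IH m; rewrite ltnS => le_mn.
have := bernoulli_genE m.+1; rewrite -hB /fps_mul !(big_ord_recr m.+1) /=.
rewrite subnn /= !mulr0 !addr0 !big_ord_recr /= subSnn /= invr1 !mulr1.
rewrite [X in X + _ = _ -> _](eq_bigr
  (fun i : 'I_m => B i / (i`!)%:R * fps_expm1 (m.+1 - i)%N)); last first.
  by move=> i _; rewrite IH // (leq_trans (ltn_ord i)).
move/addrI => H; apply/esym; apply: (mulIf _ H).
by rewrite invr_eq0 pnatr_eq0 -lt0n fact_gt0.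
Qed.

(* Main.v *)
Require Import Defs.
From mathcomp Require Import all_boot all_order all_algebra.

Import GRing.Theory.

Local Open Scope ring_scope.

(** Put [c m = (-1)^m B_m].  The recurrence for the [B_m] says that the inverse
    binomial transform of [c] is [c n - [n = 1]]; binomial inversion turns this
    into [\sum_(m < n) 'C(n, m) c m = n].  These equations say that the vector
    [(c 1, ..., c k)] is mapped to the last column of [bernoulli_mx k] by the
    lower triangular matrix [('C(i + 2, j + 1))], whose determinant is
    [(k + 1)!], so Cramer's rule gives [c k]. *)

Lemma natr_fact_neq0 n : (n`!)%:R != 0 :> rat.
Proof. by rewrite Num.Theory.pnatr_eq0 -lt0n fact_gt0. Qed.

(** This is n! times the coefficient of t^n in B(t) (e^t - 1) = t; the term m = n is absent because
    e^t - 1 has no constant term. *)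
Lemma sum_bin_bernoulli n :
  \sum_(m < n) 'C(n, m)%:R * bernoulli m = (n == 1%N)%:R.
Proof.
have := congr1 (fun x => (n`!)%:R * x) (bernoulli_genE n).
rewrite /fps_mul big_ord_recr /= subnn mulr0 addr0 /fps_X mulr_sumr.
have -> : (n`!)%:R * (n == 1%N)%:R = (n == 1%N)%:R :> rat.
  by case: eqP => [->|_]; rewrite ?mulr0 ?mulr1.
move=> <-; apply: eq_bigr => i _.
have -> : fps_expm1 (n - i)%N = ((n - i)`!)%:R^-1.
  by rewrite -(subnSK (ltn_ord i)).
rewrite -(bin_fact (ltnW (ltn_ord i))) !natrM.
have hi := natr_fact_neq0 i; have hni := natr_fact_neq0 (n - i)%N.
rewrite [bernoulli i / _]mulrC; move: (bernoulli i) => b.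
rewrite -!mulrA; congr (_ * _).
by rewrite mulrCA mulVKf // mulrCA mulfV ?mulr1.
Qed.

Lemma coef_XsubC1_exp (R : comNzRingType) m i :
  (('X - 1 : {poly R}) ^+ m)`_i = 'C(m, i)%:R * (-1) ^+ (m - i).
Proof.
rewrite addrC exprDn coef_sum.
under eq_bigr => j _.
  rewrite -polyC1 -polyCN -polyC_exp coefMn coefCM coefXn; over.
have [le_im|lt_mi] := leqP i m; last first.
  rewrite bin_small // mul0r big1 // => j _.
  by rewrite gtn_eqF ?mulr0 ?mul0rn // (leq_trans (ltn_ord j)).
have lt_im : (i < m.+1)%N by [].
rewrite (bigD1 (Ordinal lt_im)) //= eqxx mulr1 mulr_natl big1 ?addr0 // => j.
by rewrite -val_eqE /= eq_sym => /negPf ->; rewrite mulr0 mul0rn.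
Qed.

Lemma binomial_inversion (R : comNzRingType) (a c : nat -> R) :
  (forall n, a n = \sum_(m < n.+1) 'C(n, m)%:R * (-1) ^+ (n - m) * c m) ->
  forall n, c n = \sum_(m < n.+1) 'C(n, m)%:R * a m.
Proof.
(* Apply the functional ['X^i |-> c i] to ['X^n = ((X - 1) + 1)^n]. *)
move=> ac n; pose phi (p : {poly R}) := \sum_(i < n.+1) p`_i * c i.
have phiX : phi 'X^n = c n.
  rewrite /phi big_ord_recr /= coefXn eqxx mul1r big1 ?add0r // => i _.
  by rewrite coefXn ltn_eqF ?mul0r.
(* The bound m <= n keeps all coefficients of (X - 1)^m within the range read by [phi]. *)
have phiXB m : (m <= n)%N -> phi (('X - 1) ^+ m) = a m.
  move=> le_mn; rewrite /phi ac (big_ord_widen n.+1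
    (fun i => 'C(m, i)%:R * (-1) ^+ (m - i) * c i)) // [RHS]big_mkcond /=.
  apply: eq_bigr => i _; rewrite coef_XsubC1_exp ltnS.
  by case: leqP => // ?; rewrite bin_small // !mul0r.
rewrite -phiX -['X](subrK 1) exprD1n /phi.
under eq_bigr => i _ do rewrite coef_sum mulr_suml.
rewrite exchange_big /=; apply: eq_bigr => m _.
rewrite -(phiXB m (ltn_ord m)) /phi mulr_sumr; apply: eq_bigr => i _.
by rewrite coefMn mulrA mulr_natl.
Qed.

Lemma sum_bin_sign_bernoulli n :
  \sum_(m < n) 'C(n, m)%:R * ((-1) ^+ m * bernoulli m) = n%:R.
Proof.
pose c m := (-1) ^+ m * bernoulli m.
(* Since (-1)^(m-i) (-1)^i = (-1)^m, the terms i < m add up to (-1)^m [m = 1] = -[m = 1]; the term i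
   = m is [c m]. *)
have H m : c m - (m == 1%N)%:R =
    \sum_(i < m.+1) 'C(m, i)%:R * (-1) ^+ (m - i) * c i.
  rewrite big_ord_recr /= subnn binn !mul1r addrC; congr (_ + _).
  have -> : - (m == 1%N)%:R = (-1) ^+ m * (m == 1%N)%:R :> rat.
    by case: eqP => [->|_]; rewrite ?mulr0 ?oppr0 // mulr1.
  rewrite -sum_bin_bernoulli mulr_sumr; apply: eq_bigr => i _.
  rewrite /c mulrCA -!mulrA; congr (_ * _).
  by rewrite mulrA -exprD subnK // ltnW.
have sum_delta :
    \sum_(m < n.+1) 'C(n, m)%:R * (m == 1%N :> nat)%:R = n%:R :> rat.
  case: n => [|n]; first by rewrite big_ord1 mulr0.
  rewrite big_ord_recl mulr0 add0r big_ord_recl mulr1 bin1 big1 ?addr0 // => i _.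
  by rewrite mulr0.
(* The top term of the inverted sum contains [c n], which cancels the left-hand side. *)
have := binomial_inversion _ _ _ H n.
under eq_bigr => i _ do rewrite mulrBr.
rewrite sumrB sum_delta big_ord_recr /= binn mul1r addrAC.
by rewrite -[LHS]add0r => /addIr /esym /eqP; rewrite subr_eq0 => /eqP.
Qed.

Theorem mainTheorem2 (k : nat) (hk : (1 <= k)%N) :
  bernoulli k = (-1) ^+ k / ((k.+1)`!)%:R * \det (bernoulli_mx k).
Proof.
case: k hk => // k _; pose c m := (-1) ^+ m * bernoulli m.
pose L : 'M[rat]_k.+1 :=
  \matrix_(i, j) if (i < j)%N then 0 else 'C(i.+2, j.+1)%:R.
(* Cramer's rule as a product: [U] is the identity with its last column replaced by the [c i.+1], so
   [L *m U] alters only the last column of [L]. *)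
pose U : 'M[rat]_k.+1 :=
  \matrix_(i, j) if j == ord_max then c i.+1 else (i == j)%:R.
have defM : bernoulli_mx k.+1 = L *m U.
  apply/matrixP => i j; rewrite !mxE eqSS.
  under eq_bigr => m _ do rewrite !mxE.
  have -> : (j == ord_max) = (j == k :> nat) by rewrite -val_eqE.
  case: ifP => [_|_]; last first.
    rewrite (bigD1 j) //= eqxx mulr1 big1 ?addr0 // => m /negPf ->.
    by rewrite mulr0.
  (* The m = 0 term is B_0 = 1; removing it turns i + 2 into the entry i + 1. *)
  have := sum_bin_sign_bernoulli i.+2; rewrite big_ord_recl /=.
  rewrite bin0 mul1r expr0 mul1r -natr1 addrC.
  have -> : bernoulli 0 = 1.
    by have := sum_bin_bernoulli 1; rewrite big_ord1 bin0 mul1r.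
  move/addIr => <-.
  rewrite (big_ord_widen k.+1 (fun m => 'C(i.+2, m.+1)%:R * c m.+1)) //.
  rewrite big_mkcond; apply: eq_bigr => m _ /=; rewrite ltnS leqNgt.
  by case: ltnP; rewrite ?mul0r.
(* The diagonal entries are i + 2 for i = 0, ..., k. *)
have detL : \det L = (k.+2)`!%:R.
  rewrite det_trig; last first.
    by apply/is_trig_mxP => i j lt_ij; rewrite mxE lt_ij.
  under eq_bigr => i _ do rewrite mxE ltnn binSn.
  rewrite -natr_prod; congr (_%:R).
  by rewrite fact_prod big_add1 /= big_ltn // mul1n big_add1 /= big_mkord.
have detU : \det U = c k.+1.
  (* [U] is upper triangular, whereas [det_trig] is about lower triangular matrices. *)
  rewrite -det_tr det_trig; last first.
    apply/is_trig_mxP => i j lt_ij; rewrite !mxE -!val_eqE /=.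
    by rewrite ltn_eqF ?gtn_eqF // (leq_trans lt_ij) // -ltnS.
  rewrite big_ord_recr /= !mxE eqxx big1 ?mul1r // => i _.
  by rewrite !mxE -val_eqE /= ltn_eqF // eqxx.
rewrite defM det_mulmx detL detU mulrA divfK ?natr_fact_neq0 //.
by rewrite mulrA -exprD addnn -signr_odd odd_double mul1r.
Qed.
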